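(* For all $x \in \{0,1\}^n$ and all $r \in [n]$, there is a circuit $C$ of size $2^\ell$ where $\ell = n/r + O(\log n)$, a labeling of the gates of $C$ by strings in $\{0,1\}^\ell$, and a map $D : \{0,1\}^\ell \to \{0,1\}^\ell$, each output bit of which is computable by a decision tree of depth $O(\log r)$, with the following properties: 1. All gates in $C$ are either fan-in-0 Constant-0 or Constant-1 gates, or fan-in-1 Copy gates (computing the identity); in particular $C$ has no input gates. 2. There are $n$ output gates $\mathsf{out}_1,\dots,\mathsf{out}_n$, a Constant-0 gate $\mathsf{g}_0$, and a Constant-1 gate $\mathsf{g}_1$ such that, for all $i \le n$, repeatedly applying $D$ to the label of $\mathsf{out}_i$ eventually yields the label of $\mathsf{g}_{x_i}$. 3. For all $i \le n$, the label of $\mathsf{out}_i$ can be computed in $\mathrm{NC}^0$ from the binary representation of $i$. 4. Given $x$ and $r$, the decision trees computing $D$ and the $\mathrm{NC}^0$ circuit in item 3 can be computed in time $\mathrm{poly}(n)$.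
   Context: $D$ maps the label of a gate to the label of its (unique) child. A function is computable in $\mathrm{NC}^0$ if each output bit depends on $O(1)$ input bits. *)

(* Defs.v *)
From mathcomp Require Import all_boot.

Set Implicit Arguments.
Unset Strict Implicit.
Unset Printing Implicit Defensive.

(** Length of the binary representation of [k > 0].  It plays the role of
    [log k] inside O(.): it lies between [log2 k] and [log2 k + 1], and unlike
    [log2 k] it does not vanish at [k = 1], where a literal "O(log k)" would
    force the bounded quantity to be 0. *)
Definition nbits (k : nat) : nat := (trunc_log 2 k).+1.

(** Binary representation on [m] bits, least significant bit first. *)
Definition binary (m k : nat) : m.-tuple bool :=
  [tuple odd (k %/ 2 ^ j) | j < m].

(** * Boolean circuits with [m] input variables and [s] gates, fan-in <= 2 *)

Inductive gate (m s : nat) : Type :=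
| Input of 'I_m
| Const of bool
| Copy of 'I_s
| Not of 'I_s
| And of 'I_s & 'I_s
| Or of 'I_s & 'I_s.

Arguments Input {m s}.
Arguments Const {m s}.
Arguments Copy {m s}.
Arguments Not {m s}.
Arguments And {m s}.
Arguments Or {m s}.

Definition children m s (g : gate m s) : seq 'I_s :=
  match g with
  | Input _ | Const _ => [::]
  | Copy h | Not h => [:: h]
  | And h h' | Or h h' => [:: h; h']
  end.

(** On the finite type ['I_s], well-foundedness of the child relation says that
    the circuit is acyclic. *)
Record circuit (m s : nat) : Type := Circuit {
  gate_of :> 'I_s -> gate m s;
  _ : well_founded (fun h g => h \in children (gate_of g))
}.

Definition gate_value m s (a : m.-tuple bool) (v : 'I_s -> bool)
    (g : gate m s) : bool :=
  match g with
  | Input k => tnth a k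
  | Const b => b
  | Copy h => v h
  | Not h => ~~ v h
  | And h h' => v h && v h'
  | Or h h' => v h || v h'
  end.

(** By acyclicity there is exactly one such [v] for each input [a]. *)
Definition evaluation m s (C : circuit m s) (a : m.-tuple bool)
    (v : 'I_s -> bool) : Prop :=
  forall g, v g = gate_value a v (C g).

Definition circuit_computes m s l (C : circuit m s) (outs : l.-tuple 'I_s)
    (f : m.-tuple bool -> l.-tuple bool) : Prop :=
  forall a, exists2 v, evaluation C a v & f a = [tuple of map v outs].

Definition depth_at_most m s (C : circuit m s) (d : nat) : Prop :=
  forall (g : 'I_s) (p : seq 'I_s),
    path (fun g h => h \in children (C g)) g p -> size p <= d.

(** Membership in NC0, with the bound [c] on the number of input bits made
    explicit: in a statement about a family of functions it has to be uniform. *)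
Definition in_NC0 (c m l : nat) (f : m.-tuple bool -> l.-tuple bool) : Prop :=
  forall j : 'I_l, exists2 S : {set 'I_m}, #|S| <= c &
    forall a b : m.-tuple bool,
      {in S, forall k, tnth a k = tnth b k} -> tnth (f a) j = tnth (f b) j.

(** * Decision trees over [m] variables *)

(** [Query k t0 t1] continues with [t1] if variable [k] is 1, else [t0]. *)
Inductive dtree (m : nat) : Type :=
| Leaf of bool
| Query of 'I_m & dtree m & dtree m.

Fixpoint dtree_depth m (t : dtree m) : nat :=
  match t with
  | Leaf _ => 0
  | Query _ t0 t1 => (maxn (dtree_depth t0) (dtree_depth t1)).+1
  end.

Fixpoint dtree_eval m (t : dtree m) (a : m.-tuple bool) : bool :=
  match t with
  | Leaf b => b
  | Query k t0 t1 => if tnth a k then dtree_eval t1 a else dtree_eval t0 a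
  end.

(** * Running time

    Programs over finitely many registers, each holding a bit string that can
    only be accessed at its head, one bit per time step.  Keeping each register
    on a tape of its own, with the head of the string under the tape head, a
    multitape Turing machine executes each step in O(1) moves.  Conversely a
    tape is a pair of registers (the parts left and right of the tape head), so
    a program executes each move in O(1) steps.  Running times therefore agree
    with those of multitape Turing machines up to constant factors. *)

Inductive prog : Type :=
| Skip
| Push of nat & bool
| Pop of nat
| Seq of prog & prog
| If of nat & prog & prog
| While of nat & prog.

Definition store : Type := nat -> seq bool.

Definition update (s : store) (k : nat) (w : seq bool) : store :=
  fun k' => if k' == k then w else s k'.

(** [exec p s t s']: started in [s], [p] halts in [s'] after exactly [t] steps.
    [If k p q] runs [p] if the head of register [k] is 1, and [q] if it is 0 or
    the register is empty; [While k p] loops as long as register [k] is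
    nonempty.  Each test takes one step. *)
Inductive exec : prog -> store -> nat -> store -> Prop :=
| exec_skip s :
    exec Skip s 1 s
| exec_push k b s :
    exec (Push k b) s 1 (update s k (b :: s k))
| exec_pop k s :
    exec (Pop k) s 1 (update s k (behead (s k)))
| exec_seq p q s s' s'' t t' :
    exec p s t s' -> exec q s' t' s'' -> exec (Seq p q) s (t + t') s''
| exec_if k p q s s' t :
    exec (if head false (s k) then p else q) s t s' ->
    exec (If k p q) s t.+1 s'
| exec_while_stop k p s :
    s k = [::] -> exec (While k p) s 1 s
| exec_while_loop k p s s' s'' t t' :
    s k <> [::] -> exec p s t s' -> exec (While k p) s' t' s'' ->
    exec (While k p) s (t + t').+1 s''.

(** The [k]-th argument is initially in register [k], all other registers are
    empty; the result is left in register 0. *)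
Definition computes_within (p : prog) (args : seq (seq bool)) (res : seq bool)
    (bound : nat) : Prop :=
  exists t s, [/\ exec p (nth [::] args) t s, s 0 = res & t <= bound].

(** * Self-delimiting encodings of the objects output by programs

    The numbers are indices of variables and gates; they are at most the size
    of the encoded object, so writing them in unary costs only a polynomial. *)

Definition code_nat (k : nat) : seq bool := rcons (nseq k true) false.

Definition code_seq (A : Type) (code : A -> seq bool) (s : seq A) : seq bool :=
  rcons (flatten [seq true :: code y | y <- s]) false.

Fixpoint code_dtree m (t : dtree m) : seq bool :=
  match t with
  | Leaf b => [:: false; b]
  | Query k t0 t1 => true :: code_nat k ++ code_dtree t0 ++ code_dtree t1
  end.

Definition code_gate m s (g : gate m s) : seq bool :=
  match g with
  | Input k => [:: false; false; false] ++ code_nat k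
  | Const b => [:: false; false; true; b]
  | Copy h => [:: false; true; false] ++ code_nat h
  | Not h => [:: false; true; true] ++ code_nat h
  | And h h' => [:: true; false; false] ++ code_nat h ++ code_nat h'
  | Or h h' => [:: true; false; true] ++ code_nat h ++ code_nat h'
  end.

Definition code_circuit m s l (C : circuit m s) (outs : l.-tuple 'I_s) :
    seq bool :=
  code_seq (@code_gate m s) [seq C g | g <- enum 'I_s]
  ++ code_seq (fun g : 'I_s => code_nat g) outs.

(* Main.v *)
Require Import Defs.
From mathcomp Require Import all_boot zify.
From Stdlib Require Import FunctionalExtensionality.

(** A label consists of [m = nbits n] index bits, [a] zeros, an [m.+1]-bit counter
    in unary, and [h + h] data bits, where [2 ^ a > r] and [h + h] is
    [n / r + O(1)].  The output gate of [v] carries [v] in its index bits and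
    zeros elsewhere.  The first application of [D] uses the low [a] bits [o] of
    [v] to load [x_(k 2^a + o)] into the [k]-th data bit, which takes a complete
    decision tree of depth [a = O(log r)], and shifts the index by [a].  Each
    further application uses the lowest index bit [b] to replace the [k]-th data
    bit by the [(2 k + b)]-th one, and shifts the index by one.  After [s] index
    bits have been consumed the [k]-th data bit is [x_(k 2^s + v mod 2^s)] (zero
    outside of the range of [x]); so in the end the only data bit that may differ
    from 0 is the first one, which is [x_v].  A 1 enters the counter in each
    step, whence a circuit with these copy gates is acyclic.

    All loops of the program printing [D] run for a number of iterations that is
    polynomial in [n], hence so is its running time.  The complete decision trees
    are all instances of one template, built by repeated doubling. *)

Set Implicit Arguments.
Unset Strict Implicit.
Unset Printing Implicit Defensive.

(** * Executing programs in polynomial time *)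

(** The coefficient of the time bound. A loop gets two extra units: its tests cost one step per pass
    and one step to stop, and both amounts are at most [L] to the depth of the loop. *)
Fixpoint psize (p : prog) : nat :=
  match p with
  | Skip | Push _ _ | Pop _ => 1
  | Seq p q => psize p + psize q
  | If _ p q => (psize p + psize q).+1
  | While _ p => (psize p).+2
  end.

Fixpoint pdepth (p : prog) : nat :=
  match p with
  | Skip | Push _ _ | Pop _ => 0
  | Seq p q | If _ p q => maxn (pdepth p) (pdepth q)
  | While _ p => (pdepth p).+1
  end.

(** If every loop entered makes at most [L] iterations, a program runs in time
    polynomial in [L], with coefficient and degree read off its syntax. *)
Definition runs (L : nat) (p : prog) (s s' : store) : Prop :=
  0 < L -> exists2 t, exec p s t s' & t <= psize p * L ^ pdepth p.

Fixpoint iters (L k : nat) (p : prog) (N : nat) (s s' : store) : Prop :=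
  if N is N'.+1 then
    exists s1, [/\ s k <> [::], runs L p s s1 & iters L k p N' s1 s']
  else s = s'.

Definition block : seq prog -> prog := foldr Seq Skip.
Arguments block : simpl never.

(** The default of [nth] leaves all registers beyond the list empty. *)
Definition st (l : seq (seq bool)) : store := nth [::] l.

Definition ones (c : nat) : seq bool := nseq c true.

Lemma onesS c : ones c.+1 = true :: ones c. Proof. by []. Qed.

Lemma size_ones c : size (ones c) = c. Proof. exact: size_nseq. Qed.

Lemma update_st l k w : update (st l) k w = st (set_nth [::] l k w).
Proof.
by apply: functional_extensionality => i; rewrite /st nth_set_nth.
Qed.

Ltac store_ext :=
  apply: functional_extensionality => ?; rewrite /update;
  repeat (case: eqP => ?; subst => //=); try congruence.

Section Runs.

Variable L : nat.

Lemma runs_skip s : runs L Skip s s.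
Proof. by move=> L0; exists 1; [exact: exec_skip | rewrite expn0]. Qed.

Lemma runs_push k b s : runs L (Push k b) s (update s k (b :: s k)).
Proof. by move=> L0; exists 1; [exact: exec_push | rewrite expn0]. Qed.

Lemma runs_pop k s : runs L (Pop k) s (update s k (behead (s k))).
Proof. by move=> L0; exists 1; [exact: exec_pop | rewrite expn0]. Qed.

Lemma runs_seq p q s s1 s2 :
  runs L p s s1 -> runs L q s1 s2 -> runs L (Seq p q) s s2.
Proof.
move=> hp hq L0; have [t e ht] := hp L0; have [t' e' ht'] := hq L0.
exists (t + t'); first exact: exec_seq e e'.
rewrite /= mulnDl; apply: leq_add.
- by apply: leq_trans ht _; rewrite leq_mul2l leq_pexp2l ?leq_maxl ?orbT.
- by apply: leq_trans ht' _; rewrite leq_mul2l leq_pexp2l ?leq_maxr ?orbT.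
Qed.

Lemma runs_if k p q s s' :
  runs L (if head false (s k) then p else q) s s' -> runs L (If k p q) s s'.
Proof.
move=> h L0; have [t e ht] := h L0; exists t.+1; first exact: exec_if.
rewrite /= mulSn addnC -addn1 leq_add ?expn_gt0 ?L0 //; apply: leq_trans ht _.
case: ifP => _; apply: leq_mul; rewrite ?leq_pexp2l ?leq_maxl ?leq_maxr //.
  exact: leq_addr.
exact: leq_addl.
Qed.

Lemma runs_while k p N s s' :
  iters L k p N s s' -> s' k = [::] -> N <= L -> runs L (While k p) s s'.
Proof.
move=> it e hN L0.
have [t et ht]: exists2 t, exec (While k p) s t s' &
    t <= N * (psize p * L ^ pdepth p).+1 + 1.
  elim: N s it {hN} => [|N IH] s /=.
    by move=> ->; exists 1; [exact: exec_while_stop | rewrite mul0n].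
  case=> s1 [hk r it]; have [t1 e1 h1] := r L0; have [t2 e2 h2] := IH _ it.
  by exists (t1 + t2).+1; [exact: exec_while_loop e1 e2 | lia].
exists t => //; apply: leq_trans ht _ => /=; rewrite expnS.
have: 0 < L ^ pdepth p by rewrite expn_gt0 L0.
move: (psize p) (L ^ pdepth p) => K E E0; nia.
Qed.

Lemma runs_nil s s' : s = s' -> runs L (block [::]) s s'.
Proof. by move=> ->; exact: runs_skip. Qed.

Lemma runs_cons p ps s s1 s2 :
  runs L p s s1 -> runs L (block ps) s1 s2 -> runs L (block (p :: ps)) s s2.
Proof. exact: runs_seq. Qed.

Lemma block_push k b ps l s :
  runs L (block ps) (st (set_nth [::] l k (b :: nth [::] l k))) s ->
  runs L (block (Push k b :: ps)) (st l) s.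
Proof. by rewrite -update_st; apply/runs_cons/runs_push. Qed.

Lemma block_pop k ps l s :
  runs L (block ps) (st (set_nth [::] l k (behead (nth [::] l k)))) s ->
  runs L (block (Pop k :: ps)) (st l) s.
Proof. by rewrite -update_st; apply/runs_cons/runs_pop. Qed.

End Runs.

(** A step lengthens a register by at most one bit. This bounds the length of the output, hence the
    cost of its final reversal, by the time already spent. *)
Lemma exec_size p s t s' : exec p s t s' ->
  forall k, size (s' k) <= size (s k) + t.
Proof.
elim => {p s t s'} /= [s k|k b s k'|k s k'|p q s s' s'' t t' _ h1 _ h2 k'
  |k p q s s' t _ h k'|k p s _ k'|k p s s' s'' t t' _ _ h1 _ h2 k'].
- lia.
- by rewrite /update; case: eqP => [->|_] /=; lia.
- by rewrite /update; case: eqP => [->|_] /=; rewrite ?size_behead; lia.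
- by have := h1 k'; have := h2 k'; lia.
- by have := h k'; lia.
- lia.
- by have := h1 k'; have := h2 k'; lia.
Qed.

(** * Moving, copying and writing strings *)

Definition move (k o : nat) : prog :=
  While k (block [:: If k (Push o true) (Push o false); Pop k]).

(** Meant for unary contents: ones are written whatever is read. The scratch register [t] starts and
    ends empty. *)
Definition copy (k t o : nat) : prog :=
  block [:: move k t;
            While t (block [:: Pop t; Push k true; Push o true])].

Definition emit (w : seq bool) (o : nat) : prog := block [seq Push o b | b <- w].

Section Macros.

Variable L : nat.

Lemma runs_move k o s : k != o -> size (s k) <= L ->
  runs L (move k o) s (update (update s o (catrev (s k) (s o))) k [::]).
Proof.
move=> /eqP ko hk; apply: (@runs_while _ _ _ (size (s k))) => //; last first.
  by rewrite /update eqxx.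
move e: (s k) => w; elim: w {hk} s e => [|b w IH] s e /=; first by store_ext.
exists (update (update s o (b :: s o)) k w); split; first by rewrite e.
- apply: runs_cons; first apply: runs_if.
    by rewrite e /=; case: b {e}; apply: runs_push.
  apply: runs_cons; first exact: runs_pop.
  by apply: runs_nil; case: b e => e; store_ext; rewrite e.
- set s1 := update _ k w.
  have -> : update (update s o (catrev w (b :: s o))) k [::] =
            update (update s1 o (catrev w (s1 o))) k [::].
    by rewrite /s1; store_ext.
  by apply: IH; rewrite /s1 /update eqxx.
Qed.

Lemma runs_moveu k o c s : k != o -> s k = ones c -> c <= L ->
  runs L (move k o) s (update (update s o (ones c ++ s o)) k [::]).
Proof.
move=> ko e hc.
have -> : ones c ++ s o = catrev (s k) (s o).
  by rewrite e catrevE /ones rev_nseq.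
by apply: runs_move => //; rewrite e size_ones.
Qed.

Lemma runs_copy k t o c s : uniq [:: k; t; o] -> s k = ones c -> s t = [::] ->
  c <= L -> runs L (copy k t o) s (update s o (ones c ++ s o)).
Proof.
rewrite /= !inE negb_or !andbT => /andP[/andP[/eqP kt /eqP ko] /eqP ot] ek et hc.
rewrite /copy.
apply: runs_cons; first by apply: (runs_moveu _ ek hc); apply/eqP.
apply: runs_cons; last exact: (runs_nil (erefl _)).
apply: (@runs_while _ _ _ c) => //; last by rewrite /update; case: eqP.
set s1 := update _ _ _.
(* Loop invariant: while [d] ones are left in [t], the other [c - d] are back in [k] and also on
   [o]. *)
have es1 d : d <= c -> iters L t (block [:: Pop t; Push k true; Push o true]) d
  (update (update (update s t (ones d)) k (ones (c - d))) o
    (ones (c - d) ++ s o))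
  (update s o (ones c ++ s o)).
  elim: d => [|d IH] hd /=.
    by rewrite subn0; store_ext.
  exists (update (update (update s t (ones d)) k (ones (c - d))) o
            (ones (c - d) ++ s o)).
  split; [rewrite /update; repeat (case: eqP => ? //=); congruence | |
          exact: IH (ltnW hd)].
  have -> : c - d = (c - d.+1).+1 by lia.
  rewrite onesS; apply: runs_cons; first exact: runs_pop.
  apply: runs_cons; first exact: runs_push.
  apply: runs_cons; first exact: runs_push.
  by apply: runs_nil; store_ext.
have -> : s1 = update (update (update s t (ones c)) k (ones (c - c))) o
    (ones (c - c) ++ s o).
  rewrite /s1 subnn et cats0; store_ext.
exact: es1.
Qed.

Lemma runs_emit w o s : runs L (emit w o) s (update s o (catrev w (s o))).
Proof.
elim: w s => [|b w IH] s /=; first by apply: runs_nil; store_ext.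
apply: runs_cons; first exact: runs_push.
have -> : update s o (catrev w (b :: s o)) = update (update s o (b :: s o)) o
  (catrev w (update s o (b :: s o) o)) by store_ext.
exact: IH.
Qed.

Lemma block_move k o ps l s : k != o -> size (nth [::] l k) <= L ->
  runs L (block ps) (st (set_nth [::] (set_nth [::] l o
     (catrev (nth [::] l k) (nth [::] l o))) k [::])) s ->
  runs L (block (move k o :: ps)) (st l) s.
Proof. by rewrite -!update_st => ko hk; apply/runs_cons/runs_move. Qed.

Lemma block_moveu k o c ps l s : k != o -> nth [::] l k = ones c -> c <= L ->
  runs L (block ps) (st (set_nth [::] (set_nth [::] l o
     (ones c ++ nth [::] l o)) k [::])) s ->
  runs L (block (move k o :: ps)) (st l) s.
Proof. by rewrite -!update_st => ko hk hc; apply/runs_cons/runs_moveu. Qed.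

Lemma block_copy k t o c ps l s : uniq [:: k; t; o] -> nth [::] l k = ones c ->
  nth [::] l t = [::] -> c <= L ->
  runs L (block ps) (st (set_nth [::] l o (ones c ++ nth [::] l o))) s ->
  runs L (block (copy k t o :: ps)) (st l) s.
Proof. by rewrite -!update_st => ko hk ht hc; apply/runs_cons/runs_copy. Qed.

Lemma block_emit w o ps l s :
  runs L (block ps) (st (set_nth [::] l o (catrev w (nth [::] l o)))) s ->
  runs L (block (emit w o :: ps)) (st l) s.
Proof. by rewrite -!update_st; apply/runs_cons/runs_emit. Qed.

Lemma block_while k p N ps l l' s : iters L k p N (st l) (st l') ->
  nth [::] l' k = [::] -> N <= L ->
  runs L (block ps) (st l') s -> runs L (block (While k p :: ps)) (st l) s.
Proof. by move=> it e hN; apply/runs_cons/(runs_while it e hN). Qed.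

Lemma push_st k b l :
  runs L (Push k b) (st l) (st (set_nth [::] l k (b :: nth [::] l k))).
Proof. by rewrite -update_st; apply: runs_push. Qed.

Lemma runs_pop_st k l :
  runs L (Pop k) (st l) (st (set_nth [::] l k (behead (nth [::] l k)))).
Proof. by rewrite -update_st; apply: runs_pop. Qed.

Lemma block_copybit k o ps l s :
  runs L (block ps)
    (st (set_nth [::] l o (head false (nth [::] l k) :: nth [::] l o))) s ->
  runs L (block (If k (Push o true) (Push o false) :: ps)) (st l) s.
Proof.
rewrite -update_st; apply/runs_cons/runs_if; rewrite -/(st l k).
by case: (head _ _); apply: runs_push.
Qed.

Lemma iters_step k p N s s1 s' : s k <> [::] -> runs L p s s1 ->
  iters L k p N s1 s' -> iters L k p N.+1 s s'.
Proof. by exists s1. Qed.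

Lemma block_if k p q l l' ps s :
  runs L (if head false (nth [::] l k) then p else q) (st l) (st l') ->
  runs L (block ps) (st l') s -> runs L (block (If k p q :: ps)) (st l) s.
Proof. by move=> h; apply/runs_cons/runs_if. Qed.

End Macros.

(** * The program *)

(** Register 6 counts the bits in unary; register 15 receives them most significant first, as
    Horner's rule needs them. *)
Definition scan_radix : prog :=
  While 1 (block [:: If 1 (Push 15 true) (Push 15 false); Pop 1; Push 6 true]).

Definition horner : prog :=
  While 15 (block
    [:: While 7 (block [:: Pop 7; Push 8 true; Push 8 true]); move 8 7;
        If 15 (Push 7 true) Skip; Pop 15]).

Definition scan_input : prog :=
  While 0 (block [:: If 0 (Push 15 true) (Push 15 false); Pop 0;
                     Push 4 true; Push 5 true]).

(** Register 7 counts down from the divisor and register 8 counts up; when 7 is exhausted, the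
    quotient in 9 grows and 8 refills 7. On unary contents [If] is a test for nonemptiness. *)
Definition divide : prog :=
  While 4 (block [:: Pop 4; Pop 7; Push 8 true;
                     If 7 Skip (block [:: Push 9 true; move 8 7])]).

Definition halve : prog :=
  While 5 (block [:: Pop 5; If 5 (block [:: Pop 5; Push 15 true]) Skip]).

Definition bit_length : prog :=
  While 5 (block [:: halve; move 15 5; Push 10 true]).

(** The number of halvings that lead from [c] to 0. Unlike [nbits] it vanishes at 0, where the loop
    stops. *)
Definition lg (c : nat) : nat := if c is 0 then 0 else nbits c.

Lemma lg_half c : 0 < c -> lg c = (lg c./2).+1.
Proof.
case: c => [//|[//|c]] _; rewrite [LHS]/= /nbits trunc_log2S //.
Qed.

(** * Correctness of the arithmetic phases *)

Section Phases.

Variable L : nat.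
Implicit Types r w : seq bool.

Lemma scan_radixP r0 r2 r3 r4 r5 r7 r8 r9 r10 r11 r12 r13 r14 w a b :
  iters L 1 (block [:: If 1 (Push 15 true) (Push 15 false); Pop 1; Push 6 true])
    (size w)
    (st [:: r0; w; r2; r3; r4; r5; ones a; r7; r8; r9; r10; r11; r12; r13; r14; b])
    (st [:: r0; [::]; r2; r3; r4; r5; ones (size w + a); r7; r8; r9; r10; r11; r12;
            r13; r14; catrev w b]).
Proof.
elim: w a b => [//|c w IH] a b.
rewrite [size _]/= addSnnS.
apply: iters_step; last exact: (IH a.+1 (c :: b)); first by [].
by apply: block_copybit; apply: block_pop; apply: block_push; apply: runs_nil.
Qed.

Lemma scan_inputP r1 r2 r3 r6 r7 r8 r9 r10 r11 r12 r13 r14 w n b :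
  iters L 0 (block [:: If 0 (Push 15 true) (Push 15 false); Pop 0;
                     Push 4 true; Push 5 true])
    (size w)
    (st [:: w; r1; r2; r3; ones n; ones n; r6; r7; r8; r9; r10; r11; r12; r13; r14; b])
    (st [:: [::]; r1; r2; r3; ones (size w + n); ones (size w + n); r6; r7; r8; r9;
            r10; r11; r12; r13; r14; catrev w b]).
Proof.
elim: w n b => [//|c w IH] n b.
rewrite [size _]/= addSnnS.
apply: iters_step; last exact: (IH n.+1 (c :: b)); first by [].
apply: block_copybit; apply: block_pop; apply: block_push.
by apply: block_push; apply: runs_nil.
Qed.

Lemma doubleP r0 r1 r2 r3 r4 r5 r6 r9 r10 r11 r12 r13 r14 r15 c v :
  iters L 7 (block [:: Pop 7; Push 8 true; Push 8 true]) c
    (st [:: r0; r1; r2; r3; r4; r5; r6; ones c; ones v; r9; r10; r11; r12; r13; r14;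
            r15])
    (st [:: r0; r1; r2; r3; r4; r5; r6; [::]; ones (c.*2 + v); r9; r10; r11; r12;
            r13; r14; r15]).
Proof.
elim: c v => [//|c IH] v.
rewrite doubleS !addSn -!addnS.
apply: iters_step; last exact: (IH v.+2); first by [].
by apply: block_pop; apply: block_push; apply: block_push; apply: runs_nil.
Qed.

Definition msb_value (c : nat) (w : seq bool) : nat :=
  foldl (fun c (b : bool) => b + c.*2) c w.

(** Horner's accumulator never decreases, so a bound on the final value bounds all the doubling
    loops on the way. *)
Lemma msb_value_ge c w : c <= msb_value c w.
Proof.
elim: w c => [//|b w IH] c /=; apply: leq_trans (IH _); lia.
Qed.

Lemma hornerP r0 r1 r2 r3 r4 r5 r6 r9 r10 r11 r12 r13 r14 w c :
  msb_value c w <= L ->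
  iters L 15 (block
    [:: While 7 (block [:: Pop 7; Push 8 true; Push 8 true]); move 8 7;
        If 15 (Push 7 true) Skip; Pop 15]) (size w)
    (st [:: r0; r1; r2; r3; r4; r5; r6; ones c; [::]; r9; r10; r11; r12; r13; r14;
            w])
    (st [:: r0; r1; r2; r3; r4; r5; r6; ones (msb_value c w); [::]; r9; r10; r11;
            r12; r13; r14; [::]]).
Proof.
elim: w c => [//|b w IH] c h.
apply: iters_step; last exact: (IH (b + c.*2)); first by [].
have := msb_value_ge (b + c.*2) w; rewrite -/(msb_value c (b :: w)) => h'.
have hc : c.*2 <= L by apply: leq_trans h; apply: leq_trans h'; lia.
have hc' : c <= L by lia.
apply: block_while; first exact: (doubleP _ _ _ _ _ _ _ _ _ _ _ _ _ _ _ 0).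
- by [].
- by [].
apply: block_moveu; rewrite ?addn0 //= ?cats0.
apply: (@block_if _ _ _ _ _ [:: r0; r1; r2; r3; r4; r5; r6; ones (b + c.*2); [::];
  r9; r10; r11; r12; r13; r14; b :: w]).
  by case: b {IH h h'} => /=; [exact: push_st | exact: runs_skip].
by apply: block_pop; apply: runs_nil.
Qed.

(** Invariant: [v < d] is the part of the dividend counted since the last increment of the quotient.
    What remains in registers 7 and 8 depends on the remainder and is left existential. *)
Lemma divideP r0 r1 r2 r3 r5 r6 r10 r11 r12 r13 r14 r15 d n v q :
  v < d <= L ->
  exists r7 r8, iters L 4 (block [:: Pop 4; Pop 7; Push 8 true;
                     If 7 Skip (block [:: Push 9 true; move 8 7])]) n
    (st [:: r0; r1; r2; r3; ones n; r5; r6; ones (d - v); ones v; ones q; r10; r11; r12;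
            r13; r14; r15])
    (st [:: r0; r1; r2; r3; [::]; r5; r6; r7; r8; ones ((v + n) %/ d + q); r10;
            r11; r12; r13; r14; r15]).
Proof.
move=> hv; elim: n v q hv => [|n IH] v q hv.
  by exists (ones (d - v)), (ones v); rewrite addn0 divn_small //; lia.
have [vd|vd] := ltnP v.+1 d.
- have [|r7 [r8 h]] := IH v.+1 q; first lia.
  exists r7, r8; rewrite -addSnnS; apply: iters_step; last exact: h; first by [].
  have -> : d - v = (d - v.+1).+1 by lia.
  apply: block_pop; apply: block_pop; apply: block_push => /=.
  have -> : d - v.+1 = (d - v.+2).+1 by lia.
  by apply: block_if; [exact: runs_skip | apply: runs_nil].
(* The divisor is exhausted: the quotient gains one and the count restarts at 0. *)
- have ed : d = v.+1 by lia.
  have [|r7 [r8 h]] := IH 0 q.+1; first lia.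
  have e : (v + n.+1) %/ d + q = (0 + n) %/ d + q.+1.
    by rewrite -addSnnS -ed divnDl ?dvdnn // divnn [in 0 < d]ed add0n add1n addSnnS.
  rewrite e; exists r7, r8; apply: iters_step; last exact: h; first by [].
  have -> : d - v = 1 by lia.
  apply: block_pop; apply: block_pop; apply: block_push => /=.
  apply: block_if; last by apply: runs_nil.
  apply: block_push; apply: (@block_moveu _ _ _ v.+1) => //=; first lia.
  by rewrite cats0 subn0 ed; apply: runs_nil.
Qed.

Lemma halveP r0 r1 r2 r3 r4 r6 r7 r8 r9 r10 r11 r12 r13 r14 c v :
  iters L 5 (block [:: Pop 5; If 5 (block [:: Pop 5; Push 15 true]) Skip])
    (uphalf c)
    (st [:: r0; r1; r2; r3; r4; ones c; r6; r7; r8; r9; r10; r11; r12; r13; r14;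
            ones v])
    (st [:: r0; r1; r2; r3; r4; [::]; r6; r7; r8; r9; r10; r11; r12; r13; r14;
            ones (c./2 + v)]).
Proof.
elim/ltn_ind: c v => -[//|[|c]] IH v.
  (* A single leftover mark costs a pass but adds nothing to the half, whence [uphalf c] passes. *)
  apply: iters_step; [by [] | | by []].
  by apply: block_pop; apply: block_if; [exact: runs_skip | apply: runs_nil].
have -> : (c.+2)./2 + v = c./2 + v.+1 by rewrite /= addSnnS.
have -> : uphalf c.+2 = (uphalf c).+1 by [].
apply: iters_step; last exact: (IH c _ v.+1); first by [].
apply: block_pop; apply: block_if; last by apply: runs_nil.
by apply: block_pop; apply: block_push; apply: runs_nil.
Qed.

Lemma bit_lengthP r0 r1 r2 r3 r4 r6 r7 r8 r9 r11 r12 r13 r14 c m : c <= L ->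
  iters L 5 (block [:: halve; move 15 5; Push 10 true]) (lg c)
    (st [:: r0; r1; r2; r3; r4; ones c; r6; r7; r8; r9; ones m; r11; r12; r13; r14;
            [::]])
    (st [:: r0; r1; r2; r3; r4; [::]; r6; r7; r8; r9; ones (lg c + m); r11; r12;
            r13; r14; [::]]).
Proof.
elim/ltn_ind: c m => -[//|c] IH m hc; rewrite lg_half //.
rewrite addSnnS; apply: iters_step; last apply: (IH _ _ m.+1); [by []| |lia|lia].
apply: block_while; first exact: (halveP _ _ _ _ _ _ _ _ _ _ _ _ _ _ _ 0).
- by [].
- rewrite uphalfE; lia.
apply: (@block_moveu _ _ _ (c.+1)./2); rewrite ?addn0 //=; first lia.
by rewrite cats0; apply: block_push; apply: runs_nil.
Qed.

End Phases.

(** * Templates of complete decision trees *)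

(** A template is the code of a complete decision tree in which [None] marks the
    place of the value at a leaf. *)
Fixpoint tmpl (j : nat) : seq (option bool) :=
  if j is j'.+1 then
    Some true :: nseq j' (Some true) ++ Some false :: tmpl j' ++ tmpl j'
  else [:: None].

(** A prefix bit tells constants from holes, so that a template fits into a register of bits. *)
Definition quote (ts : seq (option bool)) : seq bool :=
  flatten [seq if o is Some b then [:: true; b] else [:: false] | o <- ts].

(** A hole becomes the code of a leaf with the next bit of [X]; once [X] is used up, [head false]
    pads it with zeros. *)
Fixpoint fill (ts : seq (option bool)) (X : seq bool) : seq bool :=
  match ts with
  | [::] => [::]
  | Some b :: ts' => b :: fill ts' X
  | None :: ts' => false :: head false X :: fill ts' (behead X)
  end.

Definition holes (ts : seq (option bool)) : nat := count (pred1 None) ts.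

Lemma fill_cat ts ts' X :
  fill (ts ++ ts') X = fill ts X ++ fill ts' (drop (holes ts) X).
Proof.
elim: ts X => [|[b|] ts IH] X; first by rewrite drop0.
  by rewrite /= IH.
by rewrite /= IH /= add1n; case: X => [|c X].
Qed.

Lemma fill_some b j ts X : fill (nseq j (Some b) ++ ts) X = nseq j b ++ fill ts X.
Proof. by elim: j => //= j ->. Qed.

Lemma holes_tmpl j : holes (tmpl j) = 2 ^ j.
Proof.
elim: j => [//|j IH]; rewrite /holes /= count_cat count_nseq /= count_cat.
by rewrite -!/(holes _) IH expnS; lia.
Qed.

Lemma quote_cat ts ts' : quote (ts ++ ts') = quote ts ++ quote ts'.
Proof. by rewrite /quote map_cat flatten_cat. Qed.

Lemma size_quote_some j b : size (quote (nseq j (Some b))) = j.*2.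
Proof. by elim: j => //= j IH; rewrite doubleS -IH. Qed.

Lemma quote_tmplS j : quote (tmpl j.+1) =
  [:: true; true] ++ quote (nseq j (Some true)) ++ [:: true; false]
  ++ quote (tmpl j) ++ quote (tmpl j).
Proof.
by rewrite -[tmpl j.+1]/([:: Some true] ++ nseq j _ ++ [:: Some false] ++ _ ++ _)
  !quote_cat.
Qed.

(** The summand [a.+2.*2] strengthens the induction: going from [j] to [j.+1] doubles it along with
    the size, and the surplus pays for the header of the new root. *)
Lemma size_quote_tmpl a j : j <= a ->
  size (quote (tmpl j)) + a.+2.*2 <= 2 ^ j * a.+3.*2.
Proof.
elim: j => [|j IH] ja; first by rewrite /= expn0; lia.
have {IH} := IH (ltnW ja).
rewrite quote_tmplS !size_cat size_quote_some expnS /=; lia.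
Qed.

Lemma size_tmpl ts : size ts <= size (quote ts).
Proof. by elim: ts => [//|[b|] ts IH]; rewrite /= ?ltnS // ltnW. Qed.

(** A pass turns [tmpl j] into [tmpl j.+1]. Register 12 is a stack, so the code grows from its end:
    two copies of the subtree, the end mark of the variable number, its [j] ones, the query mark. *)
Definition template : prog :=
  While 13 (block
    [:: While 12 (block [:: If 12 (Push 15 true) (Push 15 false);
                            If 12 (Push 3 true) (Push 3 false); Pop 12]);
        move 15 12; move 3 12; Push 12 false; Push 12 true;
        move 14 15;
        While 15 (block [:: Pop 15; Push 14 true; Push 12 true; Push 12 true]);
        Push 12 true; Push 12 true; Pop 13; Push 14 true]).

(** The template is saved in register 15 while it is consumed, then restored for the next tree. *)
Definition fill_template : prog :=
  block
    [:: While 12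
          (If 12
            (block [:: Pop 12; If 12 (Push 2 true) (Push 2 false); Push 15 true;
                       If 12 (Push 15 true) (Push 15 false); Pop 12])
            (block [:: Pop 12; Push 2 false; If 11 (Push 2 true) (Push 2 false);
                       Push 15 false; Pop 11]));
        move 15 12].

Section Template.

Variable L : nat.

Lemma dupP r0 r1 r2 r4 r5 r6 r7 r8 r9 r10 r11 r13 r14 w v v' :
  iters L 12 (block [:: If 12 (Push 15 true) (Push 15 false);
                            If 12 (Push 3 true) (Push 3 false); Pop 12]) (size w)
    (st [:: r0; r1; r2; v; r4; r5; r6; r7; r8; r9; r10; r11; w; r13; r14; v'])
    (st [:: r0; r1; r2; catrev w v; r4; r5; r6; r7; r8; r9; r10; r11; [::]; r13;
            r14; catrev w v']).
Proof.
elim: w v v' => [//|b w IH] v v'.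
apply: iters_step; last exact: (IH (b :: v) (b :: v')); first by [].
apply: block_copybit; apply: block_copybit; apply: block_pop.
exact: runs_nil.
Qed.

Lemma headerP r0 r1 r2 r3 r4 r5 r6 r7 r8 r9 r10 r11 r13 j v w :
  iters L 15 (block [:: Pop 15; Push 14 true; Push 12 true; Push 12 true]) j
    (st [:: r0; r1; r2; r3; r4; r5; r6; r7; r8; r9; r10; r11; w; r13; ones v; ones j])
    (st [:: r0; r1; r2; r3; r4; r5; r6; r7; r8; r9; r10; r11;
            quote (nseq j (Some true)) ++ w; r13; ones (j + v); [::]]).
Proof.
elim: j v w => [//|j IH] v w.
have -> : quote (nseq j.+1 (Some true)) ++ w =
          quote (nseq j (Some true)) ++ [:: true, true & w].
  by elim: j {IH} => //= j ->.
rewrite addSnnS; apply: iters_step; last exact: (IH v.+1); first by [].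
apply: block_pop; apply: block_push; apply: block_push; apply: block_push.
exact: runs_nil.
Qed.

Lemma templateP r0 r1 r2 r4 r5 r6 r7 r8 r9 r10 r11 f j :
  f + j <= L -> (forall i, i <= f + j -> size (quote (tmpl i)) <= L) ->
  iters L 13 (block
    [:: While 12 (block [:: If 12 (Push 15 true) (Push 15 false);
                            If 12 (Push 3 true) (Push 3 false); Pop 12]);
        move 15 12; move 3 12; Push 12 false; Push 12 true;
        move 14 15;
        While 15 (block [:: Pop 15; Push 14 true; Push 12 true; Push 12 true]);
        Push 12 true; Push 12 true; Pop 13; Push 14 true]) f
    (st [:: r0; r1; r2; [::]; r4; r5; r6; r7; r8; r9; r10; r11; quote (tmpl j);
            ones f; ones j; [::]])
    (st [:: r0; r1; r2; [::]; r4; r5; r6; r7; r8; r9; r10; r11;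
            quote (tmpl (f + j)); [::]; ones (f + j); [::]]).
Proof.
elim: f j => [//|f IH] j hL hq; rewrite addSnnS.
apply: iters_step; last apply: (IH j.+1); [by [] | | lia | by rewrite -addSnnS].
have hS : size (quote (tmpl j)) <= L by apply: hq; lia.
apply: block_while; first exact: dupP.
- by [].
- by [].
apply: block_move; rewrite //= ?catrevE ?cats0 ?size_rev // revK.
apply: block_move; rewrite //= ?catrevE ?cats0 ?size_rev // revK.
apply: block_push; apply: block_push => /=.
apply: block_moveu => //=; first lia.
rewrite cats0; apply: block_while; first exact: (headerP _ _ _ _ _ _ _ _ _ _ _ _ _ _ 0).
- by [].
- lia.
apply: block_push; apply: block_push; apply: block_pop; apply: block_push.
by apply: runs_nil; rewrite addn0 quote_tmplS.
Qed.

Lemma fillP r0 r1 r3 r4 r5 r6 r7 r8 r9 r10 r13 r14 o X ts v :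
  iters L 12
          (If 12
            (block [:: Pop 12; If 12 (Push 2 true) (Push 2 false); Push 15 true;
                       If 12 (Push 15 true) (Push 15 false); Pop 12])
            (block [:: Pop 12; Push 2 false; If 11 (Push 2 true) (Push 2 false);
                       Push 15 false; Pop 11])) (size ts)
    (st [:: r0; r1; o; r3; r4; r5; r6; r7; r8; r9; r10; X; quote ts; r13; r14;
            v])
    (st [:: r0; r1; catrev (fill ts X) o; r3; r4; r5; r6; r7; r8; r9; r10;
            drop (holes ts) X; [::]; r13; r14; catrev (quote ts) v]).
Proof.
elim: ts o X v => [|[b|] ts IH] o X v; first by rewrite drop0.
- apply: iters_step; last exact: (IH (b :: o) X [:: b, true & v]); first by [].
  apply: runs_if; apply: block_pop; apply: block_copybit; apply: block_push.
  by apply: block_copybit; apply: block_pop; apply: runs_nil.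
- have -> : drop (holes (None :: ts)) X = drop (holes ts) (behead X).
    by rewrite /holes /= add1n; case: X.
  apply: iters_step;
    last exact: (IH [:: head false X, false & o] (behead X) (false :: v));
    first by [].
  apply: runs_if; apply: block_pop; apply: block_push; apply: block_copybit.
  by apply: block_push; apply: block_pop; apply: runs_nil.
Qed.

End Template.

(** * Printing the output *)

Definition loop (body : seq prog) : prog :=
  block [:: While 13 (block (body ++ [:: Pop 13; Push 14 true]));
            While 14 (Pop 14)].

Section Words.

Variables (m a : nat) (ts : seq (option bool)).

(** This and the following words are the codes of single list entries, each behind the mark [true]
    of [code_seq]. Unary numbers are split into blocks whose lengths are available in registers. *)
Definition word_index (j : nat) : seq bool :=
  [:: true; true] ++ ones m ++ ones a ++ [:: false; true] ++ ones j ++ ones a ++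
  [:: false; false; false; false; true; true] ++ ones j ++
  [:: true; false; false; false; false; true].

Definition word_counter (j : nat) : seq bool :=
  [:: true; true] ++ ones m ++ ones a ++ ones j ++
  [:: false; false; false; false; true].

Definition word_low (X : seq bool) (k : nat) : seq bool :=
  [:: true; true] ++ ones m ++ ones a ++ [:: false] ++ fill ts X ++
  [:: true; false; true] ++
  ones m ++ ones a ++ ones m ++ ones k ++ ones k ++
  [:: true; false; false; false; false; true; true] ++
  ones m ++ ones a ++ ones m ++ ones k ++ ones k ++
  [:: true; true; false; false; false; false; true].

Definition word_high (X : seq bool) : seq bool :=
  [:: true; true] ++ ones m ++ ones a ++ [:: false] ++ fill ts X ++
  [:: false; false].

Definition word_gate (k : nat) : seq bool :=
  [:: true; false; false; false] ++ ones k ++ [:: false].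

Definition word_out (k : nat) : seq bool := [:: true; true] ++ ones k ++ [:: false].

(** First the trees of the index, zero, counter and data bits, then the circuit for the output
    labels. The six bits in between end the list of trees and announce the constant-0 gate of that
    circuit. *)
Definition word (h : nat) (X : seq bool) : seq bool :=
  flatten [seq word_index j | j <- iota 0 m] ++
  flatten [seq [:: true; false; false] | _ <- iota 0 a] ++
  [:: true; false; true] ++
  flatten [seq word_counter j | j <- iota 0 m] ++
  flatten [seq word_low (drop (k * holes ts) X) k | k <- iota 0 h] ++
  flatten [seq word_high (drop (k * holes ts) (drop (h * holes ts) X))
          | k <- iota 0 h] ++
  [:: false; true; false; false; true; false] ++
  flatten [seq word_gate k | k <- iota 0 m] ++ [:: false] ++
  flatten [seq word_out k | k <- iota 0 m] ++
  flatten [seq [:: true; false] | _ <- iota 0 (a + m + 1 + h + h)] ++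
  [:: false].

End Words.

Definition print_index : seq prog :=
  [:: emit [:: true; true] 2; copy 10 3 2; copy 6 3 2; emit [:: false; true] 2;
      copy 14 3 2; copy 6 3 2;
      emit [:: false; false; false; false; true; true] 2;
      copy 14 3 2; emit [:: true; false; false; false; false; true] 2].

Definition print_counter : seq prog :=
  [:: emit [:: true; true] 2; copy 10 3 2; copy 6 3 2; copy 14 3 2;
      emit [:: false; false; false; false; true] 2].

Definition print_low : seq prog :=
  [:: emit [:: true; true] 2; copy 10 3 2; copy 6 3 2; emit [:: false] 2;
      fill_template; emit [:: true; false; true] 2;
      copy 10 3 2; copy 6 3 2; copy 10 3 2; copy 14 3 2; copy 14 3 2;
      emit [:: true; false; false; false; false; true; true] 2;
      copy 10 3 2; copy 6 3 2; copy 10 3 2; copy 14 3 2; copy 14 3 2;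
      emit [:: true; true; false; false; false; false; true] 2].

Definition print_high : seq prog :=
  [:: emit [:: true; true] 2; copy 10 3 2; copy 6 3 2; emit [:: false] 2;
      fill_template; emit [:: false; false] 2].

Definition print_gate : seq prog :=
  [:: emit [:: true; false; false; false] 2; copy 14 3 2; emit [:: false] 2].

Definition print_out : seq prog :=
  [:: emit [:: true; true] 2; copy 14 3 2; emit [:: false] 2].

Definition print_word : prog :=
  block
    [:: copy 10 3 13; loop print_index;
        copy 6 3 13; loop [:: emit [:: true; false; false] 2];
        emit [:: true; false; true] 2;
        copy 10 3 13; loop print_counter;
        copy 9 3 13; loop print_low;
        copy 9 3 13; loop print_high;
        emit [:: false; true; false; false; true; false] 2;
        copy 10 3 13; loop print_gate; emit [:: false] 2;
        copy 10 3 13; loop print_out;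
        copy 9 3 13; copy 9 3 13; Push 13 true; copy 10 3 13; copy 6 3 13;
        loop [:: emit [:: true; false] 2]; emit [:: false] 2].

Section Print.

Variables (L m a h : nat) (ts : seq (option bool)) (g7 g8 : seq bool).

(* Register 2 is the reversed output, and registers 13 and 14 hold the number of
   remaining and completed iterations of the current loop. *)
Definition printing (f j : nat) (X W : seq bool) : store :=
  st [:: [::]; [::]; rev W; [::]; [::]; [::]; ones a; g7; g8; ones h; ones m; X;
         quote ts; ones f; ones j; [::]].

Lemma cat_ones_rev c W : ones c ++ rev W = rev (W ++ ones c).
Proof. by rewrite rev_cat /ones rev_nseq. Qed.

Lemma printing_emit w ps f j X W s :
  runs L (block ps) (printing f j X (W ++ w)) s ->
  runs L (block (emit w 2 :: ps)) (printing f j X W) s.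
Proof. by rewrite /printing rev_cat -catrevE => ?; apply: block_emit. Qed.

Hypotheses (mL : m <= L) (aL : a <= L) (hL : h <= L)
  (tsL : size (quote ts) <= L).

Lemma printing_copym ps f j X W s :
  runs L (block ps) (printing f j X (W ++ ones m)) s ->
  runs L (block (copy 10 3 2 :: ps)) (printing f j X W) s.
Proof. by rewrite /printing -cat_ones_rev => ?; apply: block_copy. Qed.

Lemma printing_copya ps f j X W s :
  runs L (block ps) (printing f j X (W ++ ones a)) s ->
  runs L (block (copy 6 3 2 :: ps)) (printing f j X W) s.
Proof. by rewrite /printing -cat_ones_rev => ?; apply: block_copy. Qed.

Lemma printing_copyj ps f j X W s : j <= L ->
  runs L (block ps) (printing f j X (W ++ ones j)) s ->
  runs L (block (copy 14 3 2 :: ps)) (printing f j X W) s.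
Proof.
by rewrite /printing -cat_ones_rev => jL ?; apply: (@block_copy _ _ _ _ j).
Qed.

Lemma printing_fuelm ps f j X W s :
  runs L (block ps) (printing (m + f) j X W) s ->
  runs L (block (copy 10 3 13 :: ps)) (printing f j X W) s.
Proof. by rewrite /printing [ones (m + f)]nseqD => ?; apply: block_copy. Qed.

Lemma printing_fuela ps f j X W s :
  runs L (block ps) (printing (a + f) j X W) s ->
  runs L (block (copy 6 3 13 :: ps)) (printing f j X W) s.
Proof. by rewrite /printing [ones (a + f)]nseqD => ?; apply: block_copy. Qed.

Lemma printing_fuelh ps f j X W s :
  runs L (block ps) (printing (h + f) j X W) s ->
  runs L (block (copy 9 3 13 :: ps)) (printing f j X W) s.
Proof. by rewrite /printing [ones (h + f)]nseqD => ?; apply: block_copy. Qed.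

Lemma printing_fill ps f j X W s :
  runs L (block ps) (printing f j (drop (holes ts) X) (W ++ fill ts X)) s ->
  runs L (block (fill_template :: ps)) (printing f j X W) s.
Proof.
move=> H; apply: runs_cons H.
apply: block_while; first exact: fillP.
- by [].
- exact: leq_trans (size_tmpl _) _.
apply: block_move; rewrite //= ?catrevE ?cats0 ?size_rev // revK.
by apply: runs_nil; rewrite /printing rev_cat.
Qed.

(** The hypothesis on [body] quantifies over the code [qs] that follows, since [loop] appends the
    update of its two counters. [Xs i] is the data register before pass [i]. *)
Lemma printing_loop (body : seq prog) (w : nat -> seq bool)
    (Xs : nat -> seq bool) N W ps s :
  N <= L ->
  (forall i f V qs s', i < N ->
     runs L (block qs) (printing f i (Xs i.+1) (V ++ w i)) s' ->
     runs L (block (body ++ qs)) (printing f i (Xs i) V) s') ->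
  runs L (block ps)
    (printing 0 0 (Xs N) (W ++ flatten [seq w i | i <- iota 0 N])) s ->
  runs L (block (loop body :: ps)) (printing N 0 (Xs 0) W) s.
Proof.
move=> NL hbody; apply: runs_cons.
have it : forall d j V, d + j = N ->
    iters L 13 (block (body ++ [:: Pop 13; Push 14 true])) d
      (printing d j (Xs j) V)
      (printing 0 N (Xs N) (V ++ flatten [seq w i | i <- iota j d])).
  elim=> [|d IH] j V e; first by rewrite /= cats0 -e.
  rewrite /= catA; apply: iters_step; last apply: (IH j.+1 (V ++ w j));
    [by [] | | by rewrite -e addSnnS].
  apply: hbody; first by lia.
  by apply: block_pop; apply: block_push; apply: runs_nil.
apply: block_while; first exact: (it N 0 W (addn0 N)).
- by [].
- by [].
apply: runs_cons; last exact: (runs_nil (erefl _)).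
apply: (@runs_while _ _ _ N) => //.
suff cl d X V :
  iters L 14 (Pop 14) d (printing 0 d X V) (printing 0 0 X V) by exact: cl.
elim: d => [//|d IH]; apply: iters_step; last exact: IH; first by [].
exact: runs_pop_st.
Qed.

Ltac print :=
  repeat first [apply: printing_emit | apply: printing_copym
    | apply: printing_copya | apply: printing_fill
    | (apply: printing_copyj; first by lia)].

Lemma print_wordP X : a + m + 1 + h + h <= L ->
  exists X', runs L print_word (printing 0 0 X [::])
    (printing 0 0 X' (word m a ts h X)).
Proof.
(* Each data tree consumes [holes ts] bits, so the upper [h] trees start from [X2]. *)
move=> HL; set X2 := drop (h * holes ts) X.
exists (drop (h * holes ts) X2).
rewrite /print_word.
apply: printing_fuelm; rewrite addn0.
apply: (@printing_loop _ (word_index m a) (fun _ => X)) => //.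
  move=> i f V qs s' iN H; rewrite /print_index /=; print.
  by rewrite -!catA; exact: H.
apply: printing_fuela; rewrite addn0.
apply: (@printing_loop _ (fun _ => [:: true; false; false]) (fun _ => X)) => //.
  by move=> i f V qs s' iN H; print.
apply: printing_emit; apply: printing_fuelm; rewrite addn0.
apply: (@printing_loop _ (word_counter m a) (fun _ => X)) => //.
  move=> i f V qs s' iN H; rewrite /print_counter /=; print.
  by rewrite -!catA; exact: H.
have dropS i Y : drop (holes ts) (drop (i * holes ts) Y) = drop (i.+1 * holes ts) Y.
  by rewrite drop_drop mulSn.
apply: printing_fuelh; rewrite addn0.
rewrite -{1}[X](drop0 X) -(mul0n (holes ts)).
apply: (@printing_loop _ (fun k => word_low m a ts (drop (k * holes ts) X) k)
  (fun k => drop (k * holes ts) X)) => //.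
  move=> i f V qs s' iN H; rewrite /print_low /=; print.
  by rewrite dropS -!catA; exact: H.
rewrite -/X2 -{1}[X2](drop0 X2) -(mul0n (holes ts)).
apply: printing_fuelh; rewrite addn0.
apply: (@printing_loop _ (fun k => word_high m a ts (drop (k * holes ts) X2))
  (fun k => drop (k * holes ts) X2)) => //.
  move=> i f V qs s' iN H; rewrite /print_high /=; print.
  by rewrite dropS -!catA; exact: H.
set X3 := drop _ X2.
apply: printing_emit; apply: printing_fuelm; rewrite addn0.
apply: (@printing_loop _ word_gate (fun _ => X3)) => //.
  move=> i f V qs s' iN H; rewrite /print_gate /=; print.
  by rewrite -!catA; exact: H.
apply: printing_emit; apply: printing_fuelm; rewrite addn0.
apply: (@printing_loop _ word_out (fun _ => X3)) => //.
  move=> i f V qs s' iN H; rewrite /print_out /=; print.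
  by rewrite -!catA; exact: H.
apply: printing_fuelh; apply: printing_fuelh; apply: block_push.
rewrite -/(printing (h + (h + 0)).+1 0 X3 _).
apply: printing_fuelm; apply: printing_fuela.
have -> : a + (m + (h + (h + 0)).+1) = a + m + 1 + h + h by lia.
apply: (@printing_loop _ (fun _ => [:: true; false]) (fun _ => X3)) => //.
  by move=> i f V qs s' iN H; print.
apply: printing_emit; apply: runs_nil; congr printing.
by rewrite /word -!catA cat0s.
Qed.

End Print.

(** * Binary representations *)

Lemma nbits_le n : 0 < n -> nbits n <= n.
Proof.
move=> n0; apply: leq_trans (trunc_logP (isT : 1 < 2) n0); exact: ltn_expl.
Qed.

Lemma ltn_nbits n : n < 2 ^ nbits n.
Proof. exact: trunc_log_ltn. Qed.

Lemma exp_nbits_le n : 0 < n -> 2 ^ nbits n <= 2 * n.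
Proof. by move=> n0; rewrite expnS leq_mul2l /= trunc_logP. Qed.

Lemma binaryE m k : tval (binary m k) = mkseq (fun j => odd (k %/ 2 ^ j)) m.
Proof. by rewrite /mkseq -val_enum_ord -map_comp. Qed.

Lemma binaryS m k : tval (binary m.+1 k) = odd k :: binary m k./2.
Proof.
rewrite !binaryE /mkseq /= divn1; congr cons.
rewrite -(addn0 1) iotaDl -map_comp; apply: eq_map => j /=.
by rewrite expnS divnMA divn2.
Qed.

Lemma msb_value_binary m k : k < 2 ^ m -> msb_value 0 (rev (binary m k)) = k.
Proof.
rewrite /msb_value foldl_rev; elim: m k => [|m IH] k.
  by rewrite binaryE expn0; case: k.
move=> hk; rewrite binaryS /= IH ?odd_double_half //.
by rewrite expnS in hk; lia.
Qed.

(** * The complete program and its running time *)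

Section Program.

Definition radix_width (r : nat) : nat := (nbits r).+1.

(** The successor makes [half_width n r * (2 * r)] exceed [n], so that twice as many data bits, each
    selected from [2 ^ radix_width r] entries, cover all of [false :: x]. *)
Definition half_width (n r : nat) : nat := (n %/ (2 * r)).+1.

(* Register 1 is extended to the representation of [2 * r] since dividing [n] by
   [2 * r] yields half of the number of data bits. *)
Definition construct : prog :=
  block
    [:: Push 1 false; scan_radix; horner; scan_input; move 15 11; Push 11 false;
        divide; Push 9 true; bit_length; Push 12 false; copy 6 3 13; template;
        While 14 (Pop 14); print_word].

(** The [false] in front of [x] is there because outputs are numbered from 1. The [false] pushed on
    register 12 is the quoted [tmpl 0]. *)
Lemma constructP n (x : n.-tuple bool) r : 1 <= r <= n ->
  exists2 s, runs (100 * n ^ 2) construct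
      (st [:: tval x; tval (binary (nbits r) r)]) s &
    s 0 = [::] /\
    s 2 = rev (word (nbits n) (radix_width r) (tmpl (radix_width r))
                 (half_width n r) (false :: x)).
Proof.
move=> /andP[r0 rn]; have n0 : 0 < n by apply: leq_trans rn.
(* The quoted template has at most [2 ^ a * a.+3.*2] bits with [2 ^ a <= 4 * n], which is quadratic
   in [n]; the other loops need only linear bounds. *)
set L := 100 * n ^ 2; set a := radix_width r; set h := half_width n r.
set m := nbits n.
have nL : 100 * n <= L by rewrite /L; nia.
have mn : m <= n by apply: nbits_le.
have an : a <= n.+1 by rewrite ltnS (leq_trans (nbits_le r0)).
have hn : h <= n.+1 by rewrite ltnS leq_div.
have e2a : 2 ^ a <= 4 * n by rewrite expnS; have := exp_nbits_le r0; lia.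
have tL j : j <= a -> size (quote (tmpl j)) <= L.
  move=> ja; have := size_quote_tmpl ja.
  have : 2 ^ j <= 2 ^ a by apply: leq_pexp2l.
  move: (size _) (2 ^ j) => q p; rewrite /L => pa; nia.
have -> : st [:: tval x; tval (binary (nbits r) r)] =
  st [:: tval x; tval (binary (nbits r) r); [::]; [::]; [::]; [::]; ones 0; ones 0;
         [::]; [::]; [::]; [::]; [::]; [::]; [::]; [::]].
  apply: functional_extensionality => i; rewrite /st.
  by do 16?[case: i => [//|i]]; rewrite !nth_default.
set w := tval (binary _ _).
have sw : size (false :: w) = a by rewrite /= size_tuple.
(* The leftovers of the division are fixed first, because the final store contains them. *)
have [r7 [r8 hdiv]] : exists r7 r8, iters L 4
    (block [:: Pop 4; Pop 7; Push 8 true;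
               If 7 Skip (block [:: Push 9 true; move 8 7])]) n
    (st [:: [::]; [::]; [::]; [::]; ones n; ones n; ones a; ones (2 * r - 0);
            ones 0; ones 0;
            [::]; false :: x; [::]; [::]; [::]; [::]])
    (st [:: [::]; [::]; [::]; [::]; [::]; ones n; ones a; r7; r8;
            ones ((0 + n) %/ (2 * r) + 0); [::]; false :: x; [::]; [::]; [::];
            [::]]).
  by apply: divideP; lia.
have HL : a + m + 1 + h + h <= L by lia.
have [|||| X' hprint] := @print_wordP L m a h (tmpl a) r7 r8 _ _ _ _ (false :: x) HL.
- by lia.
- by lia.
- by lia.
- exact: tL.
exists (printing m a h (tmpl a) r7 r8 0 0 X' (word m a (tmpl a) h (false :: x))) => //.
apply: block_push => /=.
apply: block_while; first exact: (scan_radixP _ _ _ _ _ _ _ _ _ _ _ _ _ _ _ 0).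
- by [].
- by rewrite sw; lia.
rewrite sw addn0 catrevE cats0.
(* A zero in front of the least significant bit doubles the value. *)
have ev : msb_value 0 (rev (false :: w)) = 2 * r.
  transitivity (2 * msb_value 0 (rev w)); last by rewrite msb_value_binary ?ltn_nbits.
  by rewrite /msb_value !foldl_rev /= add0n mul2n.
apply: block_while; first apply: (hornerP _ _ _ _ _ _ _ _ _ _ _ _ _ (c := 0)).
- by rewrite ev; lia.
- by [].
- by rewrite size_rev sw; lia.
rewrite ev.
apply: block_while; first exact: (scan_inputP _ _ _ _ _ _ _ _ _ _ _ _ _ _ 0).
- by [].
- by rewrite size_tuple; lia.
rewrite size_tuple addn0.
apply: block_move; rewrite //= ?catrevE ?cats0 ?size_rev ?size_tuple //; first lia.
rewrite revK; apply: block_push => /=.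
apply: block_while; first by rewrite -(subn0 (2 * r)); exact: hdiv.
- by [].
- by lia.
rewrite add0n addn0; apply: block_push => /=.
rewrite -/(ones (n %/ (2 * r)).+1) -/(half_width n r) -/h.
have elg : lg n = m by rewrite /m; case: (n) n0.
apply: block_while; first by apply: (bit_lengthP _ _ _ _ _ _ _ _ _ _ _ _ _ 0); lia.
- by [].
- by rewrite elg; lia.
rewrite elg addn0; apply: block_push.
apply: (@block_copy _ _ _ _ a) => //=; first lia.
rewrite cats0.
apply: block_while; first apply: (@templateP L _ _ _ _ _ _ _ _ _ _ _ a 0).
- by lia.
- by move=> i; rewrite addn0; apply: tL.
- by [].
- by lia.
rewrite addn0.
apply: runs_cons; last by apply: runs_cons; [exact: hprint | exact: runs_nil].
apply: (@runs_while _ _ _ a); [ | by [] | by lia].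
suff cl d : iters L 14 (Pop 14) d
   (printing m a h (tmpl a) r7 r8 0 d (false :: x) [::])
   (printing m a h (tmpl a) r7 r8 0 0 (false :: x) [::]) by exact: cl.
by elim: d => [//|d IH]; apply: iters_step; last exact: IH; [|exact: runs_pop_st].
Qed.

End Program.

(** The base is at most [(K * 100 ^ e).+1 * n ^ (2 * e)]; the sum of the resulting coefficient and
    degree serves as both. *)
Lemma poly_bound K e M f : exists c, forall n, 0 < n ->
  M * (K * (100 * n ^ 2) ^ e).+1 ^ f <= c * n ^ c.
Proof.
exists (M * (K * 100 ^ e).+1 ^ f + 2 * e * f) => n n0.
have h : (K * (100 * n ^ 2) ^ e).+1 <= (K * 100 ^ e).+1 * n ^ (2 * e).
  rewrite expnMn -expnM mulnA mulSn; have : 0 < n ^ (2 * e) by rewrite expn_gt0 n0.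
  lia.
apply: leq_trans (_ : M * ((K * 100 ^ e).+1 ^ f * n ^ (2 * e * f)) <= _).
  rewrite leq_mul2l expnM -expnMn; case: f => [|f]; first by rewrite orbT.
  by rewrite leq_exp2r ?h ?orbT.
rewrite mulnA; apply: leq_mul; first exact: leq_addr.
by rewrite leq_pexp2l // leq_addl.
Qed.

Lemma word_computable : exists (c : nat) (prg : prog),
  forall (n : nat) (x : n.-tuple bool) (r : nat), 1 <= r <= n ->
  computes_within prg [:: tval x; tval (binary (nbits r) r)]
    (word (nbits n) (radix_width r) (tmpl (radix_width r)) (half_width n r)
      (false :: x)) (c * n ^ c).
Proof.
have [c hc] := poly_bound (psize construct) (pdepth construct)
  (psize (move 2 0)).+1 (pdepth (move 2 0)).+1.
exists c, (Seq construct (move 2 0)) => n x r rn.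
have n0 : 0 < n by case/andP: rn; lia.
have [s hr [s0 s2]] := constructP x rn.
have [|t e ht] := hr; first by rewrite muln_gt0 expn_gt0 n0.
(* The time of [construct] is below [L'], hence so is the length of the reversed output in register
   2, which [move 2 0] has to traverse. *)
set L' := (psize construct * (100 * n ^ 2) ^ pdepth construct).+1 in hc.
have hs : size (s 2) <= L'.
  have /= := exec_size e 2; rewrite /L'; lia.
have [//|t' e' ht'] := @runs_move L' 2 0 s (isT) hs.
exists (t + t'), (update (update s 0 (catrev (s 2) (s 0))) 2 [::]); split.
- exact: exec_seq e e'.
- by rewrite /update /= s0 s2 catrevE revK cats0.
- apply: leq_trans (hc n n0); rewrite -/L'.
  have L1 : t <= L' ^ (pdepth (move 2 0)).+1.
    apply: leq_trans (_ : L' <= _); first by rewrite /L'; lia.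
    by rewrite -{1}(expn1 L') leq_pexp2l.
  rewrite mulSn leq_add //; apply: leq_trans ht' _.
  by rewrite leq_mul2l leq_pexp2l ?orbT.
Qed.

(** * The circuit *)

Lemma code_tuple_flatten (A : Type) (code : A -> seq bool) l (F : nat -> A) :
  code_seq code [tuple F p | p < l] =
  flatten [seq true :: code (F p) | p <- iota 0 l] ++ [:: false].
Proof. by rewrite /code_seq -cats1 -val_enum_ord -!map_comp. Qed.

Lemma flatten_iota_shift (F G : nat -> seq bool) b k :
  (forall i, i < k -> F (b + i) = G i) ->
  flatten [seq F p | p <- iota b k] = flatten [seq G i | i <- iota 0 k].
Proof.
move=> e; congr flatten; rewrite -[b in iota b]addn0 iotaDl -map_comp.
by apply/eq_in_map => i; rewrite mem_iota => /e.
Qed.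

Lemma odd_divn_small v m q : v < 2 ^ m -> m <= q -> odd (v %/ 2 ^ q) = false.
Proof.
by move=> vm mq; rewrite divn_small // (leq_trans vm) // leq_pexp2l.
Qed.

(** This is behind both uses of index bits: the branching of [load] on its highest variable, and the
    merging of data bits in a later step. *)
Lemma modn_expS v j : v %% 2 ^ j.+1 = odd (v %/ 2 ^ j) * 2 ^ j + v %% 2 ^ j.
Proof.
have E0 : 0 < 2 ^ j by rewrite expn_gt0.
have e : v = (v %/ 2 ^ j)./2 * 2 ^ j.+1 + (odd (v %/ 2 ^ j) * 2 ^ j + v %% 2 ^ j).
  rewrite addnA expnS mulnA -mulnDl [_ * 2 + _]addnC muln2 odd_double_half.
  exact: divn_eq.
rewrite {1}e modnMDl modn_small // expnS; have := ltn_pmod v E0.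
by case: (odd _); lia.
Qed.

Lemma binary_inj m k k' : k < 2 ^ m -> k' < 2 ^ m ->
  binary m k = binary m k' -> k = k'.
Proof.
move=> hk hk' e; rewrite -(msb_value_binary hk) -(msb_value_binary hk').
by rewrite e.
Qed.

(** * Decision trees and their codes *)

Section Trees.

Variable l0 : nat.
Notation l := l0.+1.

Definition proj_tree (p : nat) : dtree l :=
  Query (inord p) (Leaf l false) (Leaf l true).

(** Querying the highest variable first puts the bits of [X] on the leaves in their order from left
    to right, as filling a template does. *)
Fixpoint load (j : nat) (X : seq bool) : dtree l :=
  if j is j'.+1 then Query (inord j') (load j' X) (load j' (drop (2 ^ j') X))
  else Leaf l (head false X).

Lemma dtree_depth_load j X : dtree_depth (load j X) = j.
Proof. by elim: j X => //= j IH X; rewrite !IH maxnn. Qed.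

Lemma code_query p (t0 t1 : dtree l) : p < l ->
  code_dtree (Query (inord p) t0 t1) =
  true :: ones p ++ false :: code_dtree t0 ++ code_dtree t1.
Proof. by move=> pl; rewrite /= inordK // /code_nat cat_rcons. Qed.

Lemma code_proj p : p < l ->
  code_dtree (proj_tree p) =
  true :: ones p ++ [:: false; false; false; false; true].
Proof. exact: code_query. Qed.

Lemma code_load j X : j <= l -> code_dtree (load j X) = fill (tmpl j) X.
Proof.
elim: j X => [//|j IH] X jl.
rewrite /= inordK // /code_nat fill_some /= fill_cat holes_tmpl !IH ?(ltnW jl) //.
by rewrite cat_rcons.
Qed.

Lemma eval_query p t0 t1 (y : l.-tuple bool) : p < l ->
  dtree_eval (Query (inord p) t0 t1) y =
  if nth false y p then dtree_eval t1 y else dtree_eval t0 y.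
Proof. by move=> pl; rewrite /= (tnth_nth false) inordK. Qed.

Lemma eval_proj p (y : l.-tuple bool) : p < l ->
  dtree_eval (proj_tree p) y = nth false y p.
Proof. by move=> pl; rewrite eval_query //=; case: nth. Qed.

Lemma eval_load j X (y : l.-tuple bool) v : j <= l ->
  (forall p, p < j -> nth false y p = odd (v %/ 2 ^ p)) ->
  dtree_eval (load j X) y = nth false X (v %% 2 ^ j).
Proof.
elim: j X => [|j IH] X jl hy; first by rewrite modn1 /= nth0.
have hy' p : p < j -> nth false y p = odd (v %/ 2 ^ p) by move=> /ltnW; apply: hy.
rewrite [load _ _]/= eval_query // !IH ?(ltnW jl) // hy // modn_expS nth_drop.
by case: (odd _); rewrite ?mul1n.
Qed.

End Trees.

(** * The trees of [D] and the circuit for the output labels *)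

Section Construction.

Variables (m a h : nat) (X : seq bool).

Notation base := (m + a + m).+1.
Notation l0 := (m + a + m + h + h).
Notation l := l0.+1.

(* The first bit of the counter, bit [m + a], tells whether the data bits have
   been loaded.  Bit [base] is the first data bit. *)
Definition bit_tree (p : nat) : dtree l :=
  if p < m then
    Query (inord (m + a)) (proj_tree l0 (p + a)) (proj_tree l0 p.+1)
  else if p < m + a then Leaf l false
  else if p < (m + a).+1 then Leaf l true
  else if p < base then proj_tree l0 p.-1
  else
    let k := p - base in
    Query (inord (m + a)) (load l0 a (drop (k * 2 ^ a) X))
      (if k < h then
         Query (inord 0) (proj_tree l0 (base + k + k))
                         (proj_tree l0 (base + k + k).+1)
       else Leaf l false).

Definition step_trees : l.-tuple (dtree l) := [tuple bit_tree p | p < l].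

Definition step (y : l.-tuple bool) : l.-tuple bool :=
  [tuple dtree_eval (bit_tree p) y | p < l].

Definition embed (y : m.-tuple bool) : l.-tuple bool :=
  [tuple if p < m then nth false y p else false | p < l].

(** A circuit without wires suffices for [embed]: every output bit is an input or 0. *)
Definition printer_gate (g : 'I_m.+1) : gate m m.+1 :=
  if unlift ord0 g is Some k then Input k else Const false.

Lemma printer_gate_children g : children (printer_gate g) = [::].
Proof. by rewrite /printer_gate; case: unlift. Qed.

Lemma printer_wf : well_founded (fun g' g => g' \in children (printer_gate g)).
Proof. by move=> g; split=> g'; rewrite printer_gate_children. Qed.

Definition printer : circuit m m.+1 := Circuit printer_wf.

Definition printer_outs : l.-tuple 'I_m.+1 :=
  [tuple (if p < m then inord p.+1 else ord0) | p < l].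

Lemma code_step_trees :
  code_seq (@code_dtree l) step_trees =
  flatten [seq word_index m a j | j <- iota 0 m] ++
  flatten [seq [:: true; false; false] | _ <- iota 0 a] ++
  [:: true; false; true] ++
  flatten [seq word_counter m a j | j <- iota 0 m] ++
  flatten [seq word_low m a (tmpl a) (drop (k * holes (tmpl a)) X) k
          | k <- iota 0 h] ++
  flatten [seq word_high m a (tmpl a)
             (drop (k * holes (tmpl a)) (drop (h * holes (tmpl a)) X))
          | k <- iota 0 h] ++ [:: false].
Proof.
rewrite code_tuple_flatten.
have -> : iota 0 l = iota 0 (m + (a + (1 + (m + (h + h))))) by congr iota; lia.
rewrite !iotaD !map_cat !flatten_cat -!catA !add0n.
congr (_ ++ _).
  apply: flatten_iota_shift => i im; rewrite /bit_tree add0n im.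
  rewrite code_query ?code_proj; try lia.
  rewrite -[i.+1]addn1 /word_index /ones !nseqD.
  by do !rewrite -?catA /=.
congr (_ ++ _).
  apply: flatten_iota_shift => i ia; rewrite /bit_tree ltn_add2l ia.
  by rewrite ifN // -leqNgt leq_addr.
congr (_ ++ _).
  rewrite /= /bit_tree ltnn ltnNge leq_addr /= ltnS leqnn.
  by [].
rewrite cat0s; congr (_ ++ _).
  apply: flatten_iota_shift => i im; rewrite /bit_tree.
  have -> : m + a + 1 + i < m = false by lia.
  have -> : m + a + 1 + i < m + a = false by lia.
  have -> : m + a + 1 + i < (m + a).+1 = false by lia.
  have -> : m + a + 1 + i < base by lia.
  have -> : (m + a + 1 + i).-1 = m + a + i by lia.
  rewrite code_proj /word_counter /ones ?nseqD -?catA //.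
  by lia.
(* Lower and upper data bits load alike and differ only in the branch taken after loading. *)
have hT k : k < h + h -> true :: code_dtree (bit_tree (base + k)) =
  [:: true; true] ++ ones m ++ ones a ++ [:: false] ++
  fill (tmpl a) (drop (k * 2 ^ a) X) ++
  (if k < h then
     [:: true; false; true] ++
     ones m ++ ones a ++ ones m ++ ones k ++ ones k ++
     [:: true; false; false; false; false; true; true] ++
     ones m ++ ones a ++ ones m ++ ones k ++ ones k ++
     [:: true; true; false; false; false; false; true]
   else [:: false; false]).
  move=> kh; rewrite /bit_tree.
  have -> : base + k < m = false by lia.
  have -> : base + k < m + a = false by lia.
  have -> : base + k < (m + a).+1 = false by lia.
  have -> : base + k < base = false by lia.
  rewrite addKn code_query ?code_load; try lia.
  rewrite [ones (m + a)]nseqD -/(ones m) -/(ones a) -!catA.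
  rewrite [RHS]/=; congr [:: _, _ & _ ++ _ ++ _ :: _ ++ _].
  case: ifP => kh' //.
  rewrite code_query ?code_proj; try lia.
  have eb : ones (base + k + k).+1 =
      ones m ++ ones a ++ ones m ++ ones k ++ ones k ++ [:: true; true].
    have -> : (base + k + k).+1 = m + (a + (m + (k + (k + 2)))) by lia.
    by rewrite /ones !nseqD.
  have eb' : ones (base + k + k) =
      ones m ++ ones a ++ ones m ++ ones k ++ ones k ++ [:: true].
    have -> : base + k + k = m + (a + (m + (k + (k + 1)))) by lia.
    by rewrite /ones !nseqD.
  by rewrite eb eb'; do !rewrite -?catA /=.
congr (_ ++ _).
  have -> : m + a + 1 + m = base by lia.
  apply: flatten_iota_shift => k kh; rewrite hT ?ltn_addr // kh.
  by rewrite /word_low holes_tmpl.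
congr (_ ++ _).
have -> : m + a + 1 + m = base by lia.
apply: flatten_iota_shift => k kh.
have -> : base + h + k = base + (h + k) by rewrite addnA.
rewrite hT ?ltn_add2l //.
rewrite ifN -?leqNgt ?leq_addr // /word_high holes_tmpl drop_drop mulnDl addnC.
by [].
Qed.

Lemma code_printer :
  code_circuit printer printer_outs =
  [:: true; false; false; true; false] ++
  flatten [seq word_gate k | k <- iota 0 m] ++ [:: false] ++
  flatten [seq word_out k | k <- iota 0 m] ++
  flatten [seq [:: true; false] | _ <- iota 0 (a + m + 1 + h + h)] ++
  [:: false].
Proof.
rewrite /code_circuit /printer_outs
  (code_tuple_flatten _ _ (fun p => if p < m then inord p.+1 else ord0)).
have -> : iota 0 l = iota 0 (m + (a + m + 1 + h + h)) by congr iota; lia.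
rewrite iotaD map_cat flatten_cat -!catA add0n.
rewrite {1}/code_seq -cats1 enum_ordSl /= {1}/printer_gate unlift_none /=.
congr [:: _, _, _, _, _ & _].
rewrite -!map_comp -!catA -enumT; congr (_ ++ _ :: _).
  rewrite -val_enum_ord -map_comp; congr flatten; apply: eq_map => k /=.
  by rewrite /printer_gate liftK /= /word_gate /code_nat -cats1.
congr (_ ++ _).
  apply: flatten_iota_shift => i im; rewrite add0n im inordK //.
  by rewrite /code_nat -cats1.
congr (_ ++ _); apply: flatten_iota_shift => i _.
by rewrite ifN // -leqNgt leq_addr.
Qed.

Lemma code_word :
  code_seq (@code_dtree l) step_trees ++ code_circuit printer printer_outs =
  word m a (tmpl a) h X.
Proof.
by rewrite code_step_trees code_printer /word -!catA.
Qed.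

End Construction.

Arguments step : clear implicits.
Arguments embed : clear implicits.

(** * Acyclicity and labels *)

Lemma nth_mktuple l (F : nat -> bool) p :
  p < l -> nth false [tuple F i | i < l] p = F p.
Proof.
move=> pl; rewrite -(tnth_nth false _ (Ordinal pl)) tnth_mktuple //.
Qed.

Lemma eq_tuple_nth l (y z : l.-tuple bool) :
  (forall p, p < l -> nth false y p = nth false z p) -> y = z.
Proof. by move=> e; apply: eq_from_tnth => p; rewrite !(tnth_nth false) e. Qed.

Lemma rank_wf n s (C : 'I_s -> gate n s) (rank : 'I_s -> nat) :
  (forall g g', g' \in children (C g) -> rank g' < rank g) ->
  well_founded (fun g' g => g' \in children (C g)).
Proof.
move=> hC; have acc k g : rank g < k -> Acc (fun g' g => g' \in children (C g)) g.
  elim: k g => [//|k IH] g hk; split=> g' /hC hg.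
  exact: IH (leq_trans hg _).
by move=> g; apply: (acc _ g (ltnSn _)).
Qed.

Definition const_or_copy n s (b c : bool) (g : 'I_s) : gate n s :=
  if b then Const c else Copy g.

Lemma mem_const_or_copy n s b c (g g' : 'I_s) :
  g' \in children (const_or_copy n b c g) -> ~~ b /\ g' = g.
Proof. by case: b => //=; rewrite inE => /eqP. Qed.

Lemma const_or_copy_eq n s b c (g g' : 'I_s) :
  const_or_copy n b c g = Copy g' -> g = g'.
Proof. by case: b => // -[]. Qed.

Lemma const_or_copyP n s b c (g : 'I_s) :
  (exists b', const_or_copy n b c g = Const b') \/
  (exists g', const_or_copy n b c g = Copy g').
Proof. by case: b; [left; exists c | right; exists g]. Qed.

Section Label.

Variable l : nat.

Lemma card_label : #|{: l.-tuple bool}| = 2 ^ l.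
Proof. by rewrite card_tuple card_bool. Qed.

(** Gates enumerate all strings of length [l], so every value of [D] is again a label. *)
Definition label (g : 'I_(2 ^ l)) : l.-tuple bool :=
  enum_val (cast_ord (esym card_label) g).

Definition unlabel (y : l.-tuple bool) : 'I_(2 ^ l) :=
  cast_ord card_label (enum_rank y).

Lemma unlabelK : cancel unlabel label.
Proof. by move=> y; rewrite /label /unlabel cast_ordK enum_rankK. Qed.

Lemma label_inj : injective label.
Proof. by move=> g g' /enum_val_inj /cast_ord_inj. Qed.

End Label.

(** * Iterating [D] *)

Section Semantics.

Variables (m a h : nat) (X : seq bool).

Notation base := (m + a + m).+1.
Notation l0 := (m + a + m + h + h).
Notation l := l0.+1.
Notation tree := (bit_tree m a h X).
Notation step := (step m a h X).

Lemma nth_step y p : p < l -> nth false (step y) p = dtree_eval (tree p) y.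
Proof. exact: (nth_mktuple (fun p => dtree_eval (tree p) y)). Qed.

Lemma nth_embed (y : m.-tuple bool) p : p < l ->
  nth false (embed m a h y) p = if p < m then nth false y p else false.
Proof. exact: (nth_mktuple (fun p => if p < m then nth false y p else false)). Qed.

(* The label reached after [t.+1] steps from [embed (binary m v)]. *)
Definition reached (v t : nat) : l.-tuple bool :=
  [tuple if p < m then odd (v %/ 2 ^ (a + t + p))
         else if p < m + a then false
         else if p < base then p - (m + a) <= t
         else nth false X ((p - base) * 2 ^ (a + t) + v %% 2 ^ (a + t)) | p < l].

Lemma nth_reached v t p : p < l -> nth false (reached v t) p =
  if p < m then odd (v %/ 2 ^ (a + t + p))
  else if p < m + a then false
  else if p < base then p - (m + a) <= t
  else nth false X ((p - base) * 2 ^ (a + t) + v %% 2 ^ (a + t)).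
Proof.
exact: (nth_mktuple (fun p => if p < m then _ else if p < m + a then false
  else if p < base then p - (m + a) <= t else _)).
Qed.

(** The label of the distinguished Constant-[b] gate. *)
Definition final (b : bool) : l.-tuple bool :=
  [tuple if p < m + a then false else if p < base then true
         else (p == base :> nat) && b | p < l].

Lemma nth_final b p : p < l -> nth false (final b) p =
  if p < m + a then false else if p < base then true else (p == base) && b.
Proof.
exact: (nth_mktuple (fun p => if p < m + a then false
  else if p < base then true else (p == base) && b)).
Qed.

Lemma nth_final_top b : nth false (final b) (m + a + m) = true.
Proof. by rewrite nth_final ?ltnSn; [rewrite ltnNge leq_addr | lia]. Qed.

Lemma nth_final_value b : 0 < h -> nth false (final b) base = b.
Proof.
by move=> h0; rewrite nth_final ?ltnn ?eqxx; [rewrite ltnNge leqW ?leq_addr | lia].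
Qed.

Definition zeros (y : l.-tuple bool) : nat :=
  count (fun j => ~~ nth false y (m + a + j)) (iota 0 m.+1).

(** The counter is shifted by one place, a 1 enters and the top bit, which is 0, leaves. This holds
    for every label, reached from an output or not, as acyclicity of the whole circuit requires. *)
Lemma zeros_step (y : l.-tuple bool) :
  ~~ nth false y (m + a + m) -> zeros (step y) < zeros y.
Proof.
move=> yt.
have -> : zeros y = (count (fun j => ~~ nth false y (m + a + j)) (iota 0 m)).+1.
  have e : iota 0 m.+1 = iota 0 m ++ [:: m] by rewrite -[m.+1]addn1 iotaD.
  by rewrite /zeros e count_cat /= yt addn1.
rewrite ltnS /zeros /= addn0 nth_step; last by lia.
rewrite {1}/bit_tree ltnNge leq_addr /= ltnn ltnS leqnn add0n.
rewrite -[1]addn0 iotaDl count_map leq_eqVlt; apply/orP; left; apply/eqP.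
apply: eq_in_count => j; rewrite mem_iota => /andP[_ jm] /=.
rewrite nth_step; last by lia.
rewrite /bit_tree; do 3!(rewrite ifN; last by lia).
rewrite ifT; last by lia.
rewrite eval_proj; last by lia.
by congr (~~ nth _ _ _); lia.
Qed.

(** The top counter bit marks the constant gates, whose value is their first data bit. *)
Definition copy_gate n (g : 'I_(2 ^ l)) : gate n (2 ^ l) :=
  const_or_copy n (nth false (label g) (m + a + m)) (nth false (label g) base)
    (unlabel (step (label g))).

Lemma copy_gate_wf n :
  well_founded (fun g' g => g' \in children (copy_gate n g)).
Proof.
apply: (rank_wf (rank := fun g => zeros (label g))) => g g'.
by move=> /mem_const_or_copy[yt ->]; rewrite unlabelK; apply: zeros_step.
Qed.

Definition copy_circuit n : circuit n (2 ^ l) := Circuit (@copy_gate_wf n).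

Lemma depth_tree p : dtree_depth (tree p) <= a + 3.
Proof.
by rewrite /bit_tree; do 5?[case: ifP => _ /=]; rewrite ?dtree_depth_load; lia.
Qed.

Hypotheses (m0 : 0 < m) (a0 : 0 < a) (h0 : 0 < h)
  (hX : size X <= (h + h) * 2 ^ a).

Lemma step_embed v : v < 2 ^ m -> step (embed m a h (binary m v)) = reached v 0.
Proof.
move=> vm; set y := embed _ _ _ _.
have ny q : q < m + a -> nth false y q = odd (v %/ 2 ^ q).
  move=> qm; rewrite nth_embed; last by lia.
  (* The zero block makes it safe to read up to [a] places past the index, where [v] has only
     zeros. *)
  case: ltnP => qm'; last by rewrite (odd_divn_small vm qm').
  by rewrite binaryE nth_mkseq.
have yz q : m <= q < l -> nth false y q = false.
  by case/andP=> mq ql; rewrite nth_embed // ltnNge mq.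
apply: eq_tuple_nth => p pl; rewrite nth_step // nth_reached // addn0 /bit_tree.
case: ltnP => pm.
  rewrite eval_query; last by lia.
  rewrite yz; last by lia.
  rewrite eval_proj; last by lia.
  by rewrite ny ?ltn_add2r // addnC.
case: ltnP => pa //.
case: ltnP => pa'.
  by rewrite ifT /=; lia.
case: ltnP => pb.
  by rewrite eval_proj ?yz; [have -> : p - (m + a) <= 0 = false by lia | lia | lia].
rewrite eval_query; last by lia.
rewrite yz; last by lia.
rewrite (@eval_load _ _ _ _ v); [by rewrite nth_drop | lia |].
by move=> q qa; apply: ny; lia.
Qed.

Lemma step_reached v t : v < 2 ^ m -> step (reached v t) = reached v t.+1.
Proof.
move=> vm; set y := reached v t.
have yc : nth false y (m + a) = true.
  rewrite nth_reached; last by lia.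
  by rewrite ltnn ltnNge leq_addr /= ltnS leq_addr subnn.
apply: eq_tuple_nth => p pl; rewrite nth_step // nth_reached // /bit_tree.
case: ltnP => pm.
  rewrite eval_query ?yc; last by lia.
  rewrite eval_proj; last by lia.
  rewrite nth_reached; last by lia.
  have -> : a + t.+1 + p = a + t + p.+1 by lia.
  (* The top index bit reads position [m], in the zero block; bit [a + t + m] of [v] is 0 as
     well. *)
  case: ltnP => pm'; first by [].
  rewrite ifT; last by lia.
  by rewrite (odd_divn_small vm) //; lia.
case: ltnP => pa //.
case: ltnP => pa'.
  by rewrite ifT /=; lia.
case: ltnP => pb.
  rewrite eval_proj; last by lia.
  rewrite nth_reached; last by lia.
  have -> : p.-1 < m = false by lia.
  have -> : p.-1 < m + a = false by lia.
  have -> : p.-1 < base by lia.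
  lia.
rewrite eval_query ?yc; last by lia.
rewrite addnS modn_expS expnS; set s := a + t.
case: ltnP => ph; last first.
  (* From data bit [h] on, the position in [X] would be at least [(h + h) * 2 ^ s], beyond the end
     of [X]. *)
  rewrite [LHS]/= nth_default //; apply: leq_trans hX _.
  apply: leq_trans (_ : (h + h) * 2 ^ s <= _).
    by rewrite leq_mul2l leq_pexp2l ?orbT ?leq_addr.
  move: (p - base) ph (2 ^ s) => k hk E; have := leq_mul hk (leqnn E); lia.
rewrite eval_query //.
have -> : nth false y 0 = odd (v %/ 2 ^ s) by rewrite nth_reached // m0 addn0.
(* With [b] the bit consumed and [w] the lower ones, [k * (2 * 2 ^ s) + (b * 2 ^ s + w)] equals
   [(2 * k + b) * 2 ^ s + w]. *)
case: (odd _).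
- rewrite eval_proj; last by lia.
  rewrite nth_reached; last by lia.
  rewrite !ifN; try lia.
  rewrite -/s; congr nth; move: (v %% 2 ^ s) (p - base) (2 ^ s) => w k E.
  have -> : (base + k + k).+1 - base = k + k + 1 by lia.
  lia.
- rewrite eval_proj; last by lia.
  rewrite nth_reached; last by lia.
  rewrite !ifN; try lia.
  rewrite -/s; congr nth; move: (v %% 2 ^ s) (p - base) (2 ^ s) => w k E.
  have -> : base + k + k - base = k + k by lia.
  lia.
Qed.

Lemma iter_step v t : v < 2 ^ m ->
  iter t.+1 step (embed m a h (binary m v)) = reached v t.
Proof.
move=> vm; elim: t => [|t IH]; first exact: step_embed.
by rewrite iterS IH step_reached.
Qed.

(** By now [a + m] bits are consumed, which exhausts [v], and the counter has just filled up; data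
    bits other than the first point beyond [X]. *)
Lemma reached_final v : size X <= 2 ^ m -> v < 2 ^ m ->
  reached v m = final (nth false X v).
Proof.
move=> sX vm; apply: eq_tuple_nth => p pl; rewrite nth_reached // nth_final //.
have E : 2 ^ m <= 2 ^ (a + m) by rewrite leq_pexp2l // leq_addl.
case: ltnP => pm.
  by rewrite (ltn_addr a pm) (odd_divn_small vm) //; lia.
case: ltnP => pa //; case: ltnP => pb; first by lia.
rewrite modn_small; last by lia.
case: eqP => [->|pb']; first by rewrite subnn.
by rewrite nth_default //; move: E; move: (2 ^ (a + m)) => E' E; nia.
Qed.

End Semantics.

Arguments copy_gate : clear implicits.

(** * The output labels and the theorem *)

Lemma embed_inj m a h : injective (embed m a h).
Proof.
move=> y z e; apply: eq_tuple_nth => p pm.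
have pl : p < (m + a + m + h + h).+1 by lia.
by have := congr1 (fun y : _.-tuple _ => nth false y p) e; rewrite /= !nth_embed // pm.
Qed.

Lemma embed_in_NC0 m a h : in_NC0 1 (embed m a h).
Proof.
move=> j; have [jm|jm] := ltnP j m.
- exists [set Ordinal jm]; first by rewrite cards1.
  move=> y z e; rewrite !(tnth_nth false) !nth_embed // jm.
  by rewrite -!(tnth_nth false _ (Ordinal jm)) e ?set11.
- exists set0; first by rewrite cards0.
  by move=> y z _; rewrite !(tnth_nth false) !nth_embed // ltnNge jm.
Qed.

Lemma printer_computes m a h :
  circuit_computes (printer m) (printer_outs m a h) (embed m a h).
Proof.
move=> y; exists (fun g => if unlift ord0 g is Some k then tnth y k else false).
  by move=> g; rewrite /= /printer_gate; case: unlift.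
apply: eq_from_tnth => p; rewrite tnth_map !tnth_mktuple.
case: ltnP => pm; last by rewrite unlift_none.
have -> : inord p.+1 = lift ord0 (Ordinal pm) :> 'I_m.+1.
  by apply: val_inj; rewrite /= inordK.
by rewrite liftK (tnth_nth false).
Qed.

Lemma printer_depth m c : depth_at_most (printer m) c.
Proof. by move=> g [|g' p] //=; rewrite printer_gate_children. Qed.

Theorem theorem4p1 :
  exists (c : nat) (prg : prog),
  forall (n : nat) (x : n.-tuple bool) (r : nat), 1 <= r <= n ->
  exists (l : nat) (C : circuit n (2 ^ l)) (lab : 'I_(2 ^ l) -> l.-tuple bool)
    (D : l.-tuple bool -> l.-tuple bool) (T : l.-tuple (dtree l))
    (out : 'I_n -> 'I_(2 ^ l)) (gc : bool -> 'I_(2 ^ l))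
    (f : (nbits n).-tuple bool -> l.-tuple bool)
    (s : nat) (N : circuit (nbits n) s) (outs : l.-tuple 'I_s),
    (* l = n / r + O(log n) *)
    (l <= n %/ r + c * nbits n /\ n %/ r <= l + c * nbits n) /\
    (* the labels identify the gates *)
    injective lab /\
    (* D maps the label of a gate to the label of its child *)
    (forall h h', C h = Copy h' -> D (lab h) = lab h') /\
    (* the bits of D are computed by the decision trees T of depth O(log r) *)
    (forall (j : 'I_l) (y : l.-tuple bool),
       tnth (D y) j = dtree_eval (tnth T j) y) /\
    (forall j : 'I_l, dtree_depth (tnth T j) <= c * nbits r) /\
    (* item 1 *)
    (forall h, (exists b, C h = Const b) \/ (exists h', C h = Copy h')) /\
    (* item 2; D is only iterated through gates that have a child *)
    injective out /\
    (forall b, C (gc b) = Const b) /\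
    (forall i : 'I_n, exists2 t : nat,
       iter t D (lab (out i)) = lab (gc (tnth x i)) &
       forall u, u < t ->
         exists h h', lab h = iter u D (lab (out i)) /\ C h = Copy h') /\
    (* item 3; the index i : 'I_n stands for i + 1 in [n] *)
    in_NC0 c f /\
    (forall i : 'I_n, lab (out i) = f (binary (nbits n) i.+1)) /\
    (* item 4 *)
    circuit_computes N outs f /\
    depth_at_most N c /\
    computes_within prg [:: tval x; tval (binary (nbits r) r)]
      (code_seq (@code_dtree l) T ++ code_circuit N outs) (c * n ^ c).
Proof.
have [c [prg hprg]] := word_computable.
(* The 7 is for the label length: [a <= m.+1] and [h + h <= n %/ r + 2] bound it by
   [n %/ r + 3 * m + 4], and [m] is positive. *)
exists (c + 7), prg => n x r rn; have /andP[r0 rn'] := rn.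
have n0 : 0 < n by apply: leq_trans rn'.
move: (hprg n x r rn) => {}hprg.
set m := nbits n in hprg *; set a := radix_width r in hprg.
set h := half_width n r in hprg; set X := false :: tval x in hprg.
have m0 : 0 < m by [].
have a0 : 0 < a by [].
have h0 : 0 < h by [].
have am : a <= m.+1 by rewrite ltnS ltnS leq_trunc_log.
have nm : n < 2 ^ m := ltn_nbits n.
have sX : size X = n.+1 by rewrite /= size_tuple.
have hX : size X <= (h + h) * 2 ^ a.
  have := ltn_nbits r; have : n < h * (2 * r) by apply: ltn_ceil; lia.
  rewrite sX /a /radix_width expnS; move: (2 ^ nbits r) => E; nia.
have sX' : size X <= 2 ^ m by rewrite sX.
have vm (i : 'I_n) : i.+1 < 2 ^ m by apply: leq_ltn_trans nm; exact: ltn_ord.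
pose out (i : 'I_n) := unlabel (embed m a h (binary m i.+1)).
have hh : n %/ r <= h + h <= n %/ r + 2.
  rewrite /h /half_width mulnC divnMA; lia.
exists (m + a + m + h + h).+1, (copy_circuit m a h X n), (@label _).
exists (step m a h X), (step_trees m a h X), out, (fun b => unlabel (final m a h b)).
exists (embed m a h), m.+1, (printer m), (printer_outs m a h).
split; [split|split]; [nia | nia | exact: label_inj | ].
split.
  by move=> g g' /const_or_copy_eq <-; rewrite unlabelK.
split; first by move=> j y; rewrite !tnth_mktuple.
split.
  move=> j; rewrite tnth_mktuple; apply: leq_trans (depth_tree _ _ _ _ _) _.
  rewrite /a /radix_width; have : 0 < nbits r by []; nia.
split.
  by move=> g; apply: const_or_copyP.
split.
  move=> i j /(can_inj (@unlabelK _)) /embed_inj /(binary_inj (vm i) (vm j)) [e].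
  exact: val_inj.
split.
  move=> b; rewrite [gate_of _ _]/(copy_gate _ _ _ _ _ _) /copy_gate unlabelK.
  by rewrite (nth_final_top _ _ _ b) nth_final_value.
split.
  (* One application loads the data and [m] more fill the counter. *)
  move=> i; exists m.+1.
    rewrite !unlabelK iter_step ?vm // reached_final ?vm //; congr (final _ _ _ _).
    by rewrite (tnth_nth false).
  (* Before that the top counter bit is still 0, so all gates passed are copy gates. *)
  move=> t tm; set y := iter t _ _.
  exists (unlabel y), (unlabel (step m a h X y)); rewrite unlabelK; split; first by [].
  rewrite [gate_of _ _]/(copy_gate _ _ _ _ _ _) /copy_gate unlabelK.
  suff /negbTE -> : ~~ nth false y (m + a + m) by [].
  rewrite /y unlabelK.
  case: t tm {y} => [|t] tm.
    by rewrite nth_embed ?ifN //; lia.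
  rewrite iter_step ?vm // nth_reached; last by lia.
  do 2!(rewrite ifN; last by lia).
  by rewrite ifT; lia.
split.
  by move=> j; have [S hS e] := embed_in_NC0 j; exists S => //; lia.
split; first by move=> i; rewrite unlabelK.
split; first exact: printer_computes.
split; first exact: printer_depth.
rewrite code_word; case: hprg => t [s [e e0 ht]]; exists t, s; split=> //.
apply: leq_trans ht _; apply: leq_mul; first exact: leq_addr.
by rewrite leq_pexp2l // leq_addr.
Qed.
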